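(* Let $X$ and $Y$ be metric spaces, and $P$ be a set, $F:P\times X\rightrightarrows Y$, $\bar x\in X$, $\bar y\in Y$, and $\alpha>0$. The mapping $F$ is $\alpha$-subregular in $x$ uniformly in $p$ over $P$ at $(\bar x,\bar y)$ with some $\delta\in]0,+\infty]$ and $\mu\in]0,+\infty]$ if and only if $$F_p^{-1}(\bar y)\cap B_\rho(x)\ne\emptyset$$ for all $\rho\in]0,\mu[$, $p\in P$ and $x\in B_\delta(\bar x)$ with $d(\bar y,F(p,x))<\alpha\rho$. (The equivalence holds for each given pair $\delta$, $\mu$, the same on both sides.)
   Context: $B_r(z)$ denotes the open ball with center $z$ and radius $r\in]0,+\infty]$. $d(z,\Omega)=\inf_{w\in\Omega}d(z,w)$, $d(z,\emptyset)=+\infty$. For $p\in P$, $F_p^{-1}(y)=\{x\in X\mid y\in F(p,x)\}$. Definition. $F$ is $\alpha$-subregular in $x$ uniformly in $p$ over $P$ at $(\bar x,\bar y)$ with $\delta$ and $\mu$ if $\alpha\, d(x,F_p^{-1}(\bar y))\le d(\bar y,F(p,x))$ for all $p\in P$ and $x\in B_\delta(\bar x)$ with $d(\bar y,F(p,x))<\alpha\mu$. *)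

(* Defs.v *)
From HB Require Import structures.
From mathcomp Require Import all_boot all_order all_algebra.
From mathcomp Require Import all_classical all_reals all_analysis.

Set Implicit Arguments.
Unset Strict Implicit.
Unset Printing Implicit Defensive.

Import Order.TTheory GRing.Theory Num.Theory.

Local Open Scope classical_set_scope.
Local Open Scope ring_scope.
Local Open Scope ereal_scope.

(* The library's [ball] only takes a real radius; here the radius may be +oo,
   in which case the ball is the whole space. *)
Definition oball (R : realType) (T : metricType R) (z : T) (r : \bar R) :
    set T :=
  [set w | (mdist z w)%:E < r].

(* [ereal_inf set0 = +oo], so the distance to the empty set is +oo. *)
Definition dist_set (R : realType) (T : metricType R) (z : T) (A : set T) :
    \bar R :=
  ereal_inf [set (mdist z w)%:E | w in A].

(* A set-valued mapping F : P x X => Y is a function [P * X -> set Y] whose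
   values may be empty. *)
Definition partial_inv (P X Y : Type) (F : P * X -> set Y) (p : P) (y : Y) :
    set X :=
  [set x | F (p, x) y].

Definition uniformly_subregular (R : realType) (X Y : metricType R) (P : Type)
    (F : P * X -> set Y) (alpha : R) (xbar : X) (ybar : Y)
    (delta mu : \bar R) : Prop :=
  forall (p : P) (x : X), oball xbar delta x ->
    dist_set ybar (F (p, x)) < alpha%:E * mu ->
    alpha%:E * dist_set x (partial_inv F p ybar)
      <= dist_set ybar (F (p, x)).

(* Main.v *)
Require Import Defs.
From HB Require Import structures.
From mathcomp Require Import all_boot all_order all_algebra.
From mathcomp Require Import all_classical all_reals all_analysis.

Import Order.TTheory GRing.Theory Num.Theory.

Local Open Scope classical_set_scope.
Local Open Scope ring_scope.
Local Open Scope ereal_scope.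

(** By [dist_set_ltP], the ball condition says that [rho] exceeds d(x, F_p^-1(ybar)) whenever alpha
    * rho exceeds d(ybar, F(p, x)). Subregularity gives this by dividing by alpha. Conversely, if
    its inequality failed, [fin_lt_dense] would put a real [rho] strictly between d(ybar, F(p, x)) /
    alpha and both mu and d(x, F_p^-1(ybar)), a contradiction. *)

Lemma dist_set_ge0 (R : realType) (T : metricType R) (z : T) (A : set T) :
  0 <= dist_set z A.
Proof. by apply: le_ereal_inf_tmp => _ [w _ <-]; rewrite lee_fin mdist_ge0. Qed.

(** The infimum need not be attained, but the strict inequality already yields a point of [A] closer
    than [r]. *)
Lemma dist_set_ltP (R : realType) (T : metricType R) (z : T) (A : set T)
    (r : \bar R) :
  dist_set z A < r <-> A `&` oball z r !=set0.
Proof.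
split=> [/ereal_inf_lt[_ [w Aw <-] zw]|[w [Aw zw]]]; first by exists w.
by apply: le_lt_trans zw; apply: ereal_inf_lbound; exists w.
Qed.

(** The bound may be +oo, as when mu = +oo and the inverse image is empty, yet the radius must be
    real. *)
Lemma fin_lt_dense (R : realType) (a : R) (b : \bar R) :
  a%:E < b -> exists2 r : R, (a < r)%R & r%:E < b.
Proof.
case: b => [b||//] ab; last by exists (a + 1)%R; rewrite ?ltrDl ?ltry.
by exists ((a + b) / 2)%R; rewrite ?lte_fin ?midf_lt.
Qed.

Theorem proposition1p5 (R : realType) (X Y : metricType R) (P : Type)
    (F : P * X -> set Y) (xbar : X) (ybar : Y)
    (alpha : R) (alpha_gt0 : (0 < alpha)%R)
    (delta mu : \bar R) (delta_gt0 : 0 < delta) (mu_gt0 : 0 < mu) :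
  uniformly_subregular F alpha xbar ybar delta mu <->
  (forall (rho : R) (p : P) (x : X),
     (0 < rho)%R -> rho%:E < mu -> oball xbar delta x ->
     dist_set ybar (F (p, x)) < (alpha * rho)%:E ->
     partial_inv F p ybar `&` oball x rho%:E !=set0).
Proof.
split=> [Freg rho p x _ rho_mu xbarx yF|Fball p x xbarx yF].
  apply/dist_set_ltP; rewrite -(@lte_pmul2l _ alpha%:E) ?lte_fin// -EFinM.
  apply: le_lt_trans (yF); apply: Freg => //; apply: lt_trans yF _.
  by rewrite EFinM lte_pmul2l ?lte_fin.
have := dist_set_ge0 _ _ ybar (F (p, x)).
(* Nonnegativity excludes -oo; at +oo the desired bound is trivial. *)
case yFE : (dist_set ybar (F (p, x))) yF => [r| |] yF r_ge0 //;
  last by rewrite leey.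
rewrite leNgt; apply/negP => r_lt.
(* A radius above [d(ybar, F(p, x)) / alpha] but below [mu] and the distance to
   the inverse image would give a ball missing that inverse image. *)
have [rho] : exists2 rho : R, (alpha^-1 * r < rho)%R &
    rho%:E < Order.min mu (dist_set x (partial_inv F p ybar)).
  by apply: fin_lt_dense; rewrite lt_min EFinM !lte_pdivrMl // r_lt andbT.
rewrite lt_min => r_rho /andP[rho_mu rho_dist].
suff: dist_set x (partial_inv F p ybar) < rho%:E by rewrite ltNge ltW.
apply/dist_set_ltP; apply: Fball => //.
  (* [rho] is positive because it exceeds the nonnegative quotient r / alpha. *)
  by apply: le_lt_trans r_rho; rewrite mulr_ge0// invr_ge0 ltW.
by rewrite yFE lte_fin -ltr_pdivrMl.
Qed.
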